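(* Let $k$ be a (commutative) Noetherian ring and let $c$ be a non-negative integer. Then the $c$-th tensor power $A_{|\bullet|}^{\otimes c}$ of the polynomial ring functor on the category $\mathsf{Co}$ of cographs is Noetherian; that is, every submodule of a finitely generated $A_{|\bullet|}^{\otimes c}$-module is finitely generated.
   Context: All graphs are finite and simple. The class of cographs is defined inductively: the single vertex is a cograph, and if $G_1,G_2$ are cographs then so are the disjoint union $G_1\sqcup G_2$ and the edge-complements $\overline{G_1},\overline{G_2}$; equivalently, cographs are the graphs with no induced path $P_4$ on four vertices. A full embedding $G\hookrightarrow G'$ is an injection of vertex sets such that two vertices are adjacent in $G$ if and only if their images are adjacent in $G'$. $\mathsf{Co}$ is the category of cographs and full embeddings, and a $\mathsf{Co}$-module over $k$ is a functor from $\mathsf{Co}$ to $k$-modules, with images of morphisms called transition maps. For a cograph $G$ with vertex set $V_G$, $A_{|G|}=k[x_v\mid v\in V_G]$, and $A_{|G|}^{\otimes c}$ (tensor power over $k$) is the polynomial ring $k[x_{v,j}\mid v\in V_G,\ 1\le j\le c]$. A full embedding $\phi:G\hookrightarrow G'$ induces $x_{v,j}\mapsto x_{\phi(v),j}$, which makes $A_{|\bullet|}^{\otimes c}$ a functor from $\mathsf{Co}$ to $k$-algebras. An $A_{|\bullet|}^{\otimes c}$-module $V$ is a $\mathsf{Co}$-module over $k$ such that each $V_G$ is an $A_{|G|}^{\otimes c}$-module and the transition maps satisfy $\phi_*(x_{v,j}m)=x_{\phi(v),j}\,\phi_*(m)$ for every full embedding $\phi:G\hookrightarrow G'$, $v \in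 V_G$, $1\le j\le c$, $m\in V_G$-component of $V$ (i.e. $m$ in the value of $V$ at $G$). A submodule is a family of $A_{|G|}^{\otimes c}$-submodules preserved by all transition maps. Such a $V$ is finitely generated if its value at each $G$ is a finitely generated $A_{|G|}^{\otimes c}$-module and there is a finite list of cographs $G_1,\ldots,G_n$ such that for every cograph $G$, the value of $V$ at $G$ is generated as an $A_{|G|}^{\otimes c}$-module by the images of the values at the $G_i$ under transition maps. *)

(* Defs.v *)
From HB Require Import structures.
From mathcomp Require Import all_boot all_algebra.
From mathcomp.multinomials Require Import monalg.

Set Implicit Arguments.
Unset Strict Implicit.
Unset Printing Implicit Defensive.

Import GRing.Theory.
Local Open Scope ring_scope.

Record sgraph := SGraph {
  vertex :> finType;
  adj : rel vertex;
  adj_sym : symmetric adj;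
  adj_irr : irreflexive adj }.
Arguments adj {s} x y.

Section Operations.
Variables G H : sgraph.

Definition union_adj : rel (vertex G + vertex H) := fun x y =>
  match x, y with
  | inl u, inl v => adj u v
  | inr u, inr v => adj u v
  | _, _ => false
  end.

Fact union_sym : symmetric union_adj.
Proof. by case=> u [] v //=; apply: adj_sym. Qed.

Fact union_irr : irreflexive union_adj.
Proof. by case=> u /=; apply: adj_irr. Qed.

Definition disjoint_union := SGraph union_sym union_irr.

Definition compl_adj : rel G := fun x y => (x != y) && ~~ adj x y.

Fact compl_sym : symmetric compl_adj.
Proof. by move=> x y; rewrite /compl_adj eq_sym adj_sym. Qed.

Fact compl_irr : irreflexive compl_adj.
Proof. by move=> x; rewrite /compl_adj eqxx. Qed.

Definition edge_complement := SGraph compl_sym compl_irr.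

Definition full_embedding (f : {ffun G -> H}) : bool :=
  injectiveb f && [forall x, forall y, adj (f x) (f y) == adj x y].

(* [full_embedding] is boolean and its carrier consists of finite functions, so
   two embeddings are equal as soon as they agree pointwise. *)
Definition embedding := {f : {ffun G -> H} | full_embedding f}.

Definition emb_fun (f : embedding) : G -> H := val f.

End Operations.

Coercion emb_fun : embedding >-> Funclass.

Lemma emb_inj (G H : sgraph) (f : embedding G H) : injective f.
Proof. by case/andP: (valP f) => /injectiveP. Qed.

Lemma emb_adj (G H : sgraph) (f : embedding G H) x y :
  adj (f x) (f y) = adj x y.
Proof. by case/andP: (valP f) => _ /forallP/(_ x)/forallP/(_ y)/eqP. Qed.

Fact id_emb_subproof (G : sgraph) :
  full_embedding ([ffun x => x] : {ffun G -> G}).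
Proof.
apply/andP; split; first by apply/injectiveP => x y; rewrite !ffunE.
by apply/forallP => x; apply/forallP => y; rewrite !ffunE.
Qed.

Definition id_emb (G : sgraph) : embedding G G :=
  Sub _ (id_emb_subproof G).

Fact comp_emb_subproof (G H K : sgraph) (g : embedding H K)
  (f : embedding G H) : full_embedding ([ffun x => g (f x)] : {ffun G -> K}).
Proof.
apply/andP; split.
  by apply/injectiveP => x y; rewrite !ffunE => /emb_inj/emb_inj.
by apply/forallP => x; apply/forallP => y; rewrite !ffunE !emb_adj.
Qed.

Definition comp_emb (G H K : sgraph) (g : embedding H K) (f : embedding G H) :
  embedding G K := Sub _ (comp_emb_subproof g f).

(* The vertex set of a graph is an arbitrary finite type, so the inductive
   definition has to be closed under isomorphism. The graph without vertices is
   not a cograph. *)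
Inductive is_cograph : sgraph -> Prop :=
| cograph_single (G : sgraph) : #|G| = 1%N -> is_cograph G
| cograph_union (G H : sgraph) :
    is_cograph G -> is_cograph H -> is_cograph (disjoint_union G H)
| cograph_compl (G : sgraph) : is_cograph G -> is_cograph (edge_complement G)
| cograph_iso (G H : sgraph) (f : embedding G H) :
    bijective f -> is_cograph G -> is_cograph H.

Record cograph := Cograph {
  cograph_graph :> sgraph;
  cographP : is_cograph cograph_graph }.

Section Modules.
Variables (R : nzRingType) (M : lmodType R).

Definition is_submodule (N : M -> Prop) : Prop :=
  N 0 /\ forall (a : R) (x y : M), N x -> N y -> N (a *: x + y).

Definition generated (S : M -> Prop) (x : M) : Prop :=
  forall N : M -> Prop, is_submodule N -> (forall y, S y -> N y) -> N x.

Definition finitely_generated (N : M -> Prop) : Prop :=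
  exists s : seq M, forall x, N x <-> generated (fun y => y \in s) x.

End Modules.

(* The ideals of [k] are the submodules of the regular module [k^o]. *)
Definition noetherian_ring (k : comNzRingType) : Prop :=
  forall I : k^o -> Prop, is_submodule I -> finitely_generated I.

Section Algebra.
Variables (k : comNzRingType) (c : nat).

(* The polynomial ring k[x_{v,j} | v a vertex of G, 1 <= j <= c], that is, the
   monoid algebra of the commutative monomials in the x_{v,j}; the index j is
   shifted to range over 0, ..., c - 1. *)
Definition tensor_poly (G : sgraph) : comNzRingType :=
  {malg k[{cmonom (G * 'I_c)%type}]}.

Definition polyvar (G : sgraph) (v : G) (j : 'I_c) : tensor_poly G :=
  << ucm (v, j) >>.

Definition polyconst (G : sgraph) (a : k) : tensor_poly G := a%:MP.

(* [k] acts on the value at [G] through the constant polynomials, so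
   [trans_linear] is k-linearity of the transition maps. *)
Record amodule := AModule {
  amod_val :> forall G : cograph, lmodType (tensor_poly G);
  trans : forall G H : cograph, embedding G H -> amod_val G -> amod_val H;
  trans_linear : forall (G H : cograph) (f : embedding G H) (a : k)
      (x y : amod_val G),
    trans f (polyconst G a *: x + y) = polyconst H a *: trans f x + trans f y;
  trans_id : forall (G : cograph) (x : amod_val G), trans (id_emb G) x = x;
  trans_comp : forall (G H K : cograph) (g : embedding H K)
      (f : embedding G H) (x : amod_val G),
    trans (comp_emb g f) x = trans g (trans f x);
  trans_var : forall (G H : cograph) (f : embedding G H) (v : G) (j : 'I_c)
      (x : amod_val G),
    trans f (polyvar v j *: x) = polyvar (f v) j *: trans f x }.

Record subamodule (V : amodule) := SubAModule {
  sub_val :> forall G : cograph, V G -> Prop;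
  sub_submodule : forall G : cograph, is_submodule (@sub_val G);
  sub_trans : forall (G H : cograph) (f : embedding G H) (x : V G),
    sub_val x -> sub_val (trans f x) }.

Definition full_subamodule (V : amodule) : subamodule V.
Proof. by exists (fun G _ => True). Defined.

Section FiniteGeneration.
Variables (V : amodule) (W : subamodule V).

Definition trans_images (n : nat) (Gs : 'I_n -> cograph) (G : cograph)
    (y : V G) : Prop :=
  exists (i : 'I_n) (f : embedding (Gs i) G) (x : V (Gs i)),
    sub_val W x /\ y = trans f x.

(* Finite generation of [W] as a module in its own right: since [W] is closed
   under the module operations and the transition maps, the spans may be formed
   inside [V]. *)
Definition sub_fg : Prop :=
  (forall G : cograph, finitely_generated (@sub_val V W G)) /\
  exists (n : nat) (Gs : 'I_n -> cograph), forall (G : cograph) (x : V G),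
    sub_val W x <-> generated (trans_images Gs (G := G)) x.

End FiniteGeneration.

Definition amod_fg (V : amodule) : Prop := sub_fg (full_subamodule V).

End Algebra.

(* Main.v *)
Require Import Defs.
From HB Require Import structures.
From Stdlib Require Import Classical ClassicalEpsilon.
From Stdlib Require List.
From mathcomp Require Import all_boot all_algebra zify.
From mathcomp.finmap Require Import finmap.
From mathcomp.multinomials Require Import monalg.

(* A cograph with a chosen cotree carries a linear order on its vertices (the
   leaves, from left to right). If V is generated by v_1, ..., v_n, with v_j in
   the value at G_j, then V_T is spanned over k by the terms x^m f_* v_j, where f
   embeds G_j into the graph of T; a term is a labelling of the leaves of T, and
   comparing labellings lexicographically gives a well-order compatible with
   multiplication by monomials and with order-preserving embeddings. A term
   divides another one as soon as the labelled cotree of the first embeds into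
   that of the second in the sense of Kruskal's theorem, so divisibility is a
   well-quasi-order.
   If a submodule W were not finitely generated, one could choose w_0, w_1, ...,
   each outside the submodule generated by the previous ones and with the least
   possible leading term. Along a subsequence every leading term divides the
   later ones, and since k is Noetherian some leading coefficient is a
   combination of the previous ones in that subsequence. Subtracting the
   corresponding combination from w_N gives an element with a smaller leading
   term, against the choice of w_N. *)

Set Implicit Arguments.
Unset Strict Implicit.
Unset Printing Implicit Defensive.

Import GRing.Theory.

(** * Well-quasi-orders and Kruskal's theorem *)

Lemma choice_fun A (B : A -> Type) (R : forall x, B x -> Prop) :
  (forall x, exists y, R x y) -> exists f : forall x, B x, forall x, R x (f x).
Proof.
move=> RP; exists (fun x => sval (constructive_indefinite_description _ (RP x))).
by move=> x; case: constructive_indefinite_description.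
Qed.

Lemma exists_min A (P : A -> Prop) (m : A -> nat) :
  (exists x, P x) -> exists x, P x /\ forall y, P y -> m x <= m y.
Proof.
case=> x; have [n] := ubnP (m x); elim: n x => // n IHn x /ltnSE le_xn Px.
case: (classic (exists y, P y /\ m y < m x)) => [[y [Py lt_yx]] | nox].
  exact: IHn (leq_trans lt_yx le_xn) Py.
exists x; split=> // y Py; rewrite leqNgt; apply/negP => lt_yx.
by apply: nox; exists y.
Qed.

Lemma infinite_enum (P : nat -> Prop) :
  (forall n, exists i, n <= i /\ P i) ->
  exists h : nat -> nat, {homo h : i j / i < j} /\ forall i, P (h i).
Proof.
move=> /choice_fun[s sP]; pose h n := iter n (fun i => s i.+1) (s 0).
exists h; split=> [|[|n]]; [|by case: (sP 0) | by case: (sP (h n).+1)].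
by apply: homo_ltn => [? ? ?|i]; [apply: ltn_trans | case: (sP (h i).+1)].
Qed.

Section WellQuasiOrder.
Variables (A : Type).
Implicit Types (r : A -> A -> Prop) (f g : nat -> A).

Definition bad r f := forall i j, i < j -> ~ r (f i) (f j).

(** An infinite ascending subsequence is asked for, rather than one good pair, so that conjunctions
    follow by extracting a subsequence twice. *)
Definition wqo r := forall f, exists h : nat -> nat,
  {homo h : i j / i < j} /\ forall i j, i < j -> r (f (h i)) (f (h j)).

Lemma wqo_nbad r f : wqo r -> ~ bad r f.
Proof.
move=> /(_ f)[h [hP rP]] /(_ (h 0) (h 1)); apply; first exact: hP.
exact: rP.
Qed.

(** Indices with nothing above them later on would form a bad subsequence if there were infinitely
    many; past the last of them one can climb forever. *)
Lemma nbad_wqo r : (forall x y z, r x y -> r y z -> r x z) ->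
  (forall f, ~ bad r f) -> wqo r.
Proof.
move=> r_trans r_good f.
pose terminal i := forall j, i < j -> ~ r (f i) (f j).
have [N NP] : exists N, forall i, N <= i -> ~ terminal i.
  apply: NNPP => noN; have [|h [hP tP]] := @infinite_enum terminal.
    move=> n; apply: NNPP => noi; apply: noN; exists n => i le_ni ti.
    by apply: noi; exists i.
  by apply: (r_good (f \o h)) => i j lt_ij; apply: tP; apply: hP.
have sP i : exists j, N <= i -> i < j /\ r (f i) (f j).
  case: (classic (N <= i)) => [/NP nti|]; last by exists 0.
  apply: NNPP => noj; apply: nti => j lt_ij rij; apply: noj.
  by exists j.
have {sP}[s sP] := choice_fun sP.
pose h n := iter n s N.
have hN n : N <= h n.
  elim: n => //= n IHn; case: (sP _ IHn) => lt_hs _.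
  by rewrite (leq_trans IHn) // ltnW.
exists h; split.
  by apply: homo_ltn => [? ? ?|i /=]; [apply: ltn_trans | case: (sP _ (hN i))].
move=> i j lt_ij; move: i j lt_ij.
have := @homo_ltn A (fun i => f (h i)) r; apply; first by move=> y x z; apply: r_trans.
by move=> i; case: (sP _ (hN i)).
Qed.

Lemma sub_wqo r1 r2 : (forall x y, r1 x y -> r2 x y) -> wqo r1 -> wqo r2.
Proof.
by move=> r12 w1 f; have [h [hP rP]] := w1 f; exists h; split=> // i j /rP/r12.
Qed.

Lemma wqo_and r1 r2 : wqo r1 -> wqo r2 -> wqo (fun x y => r1 x y /\ r2 x y).
Proof.
move=> w1 w2 f; have [h [hP rP]] := w1 f; have [h' [hP' rP']] := w2 (f \o h).
exists (h \o h'); split=> i j lt_ij /=; first exact/hP/hP'.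
by split; [apply/rP/hP' | apply: rP'].
Qed.

End WellQuasiOrder.

Lemma wqo_preim A B (g : A -> B) (r : B -> B -> Prop) :
  wqo r -> wqo (fun x y => r (g x) (g y)).
Proof. by move=> w f; apply: (w (g \o f)). Qed.

Lemma wqo_nat : wqo (fun m n : nat => m <= n).
Proof.
apply: nbad_wqo => [x y z|f fP]; first exact: leq_trans.
have [|i [_ min_i]] := @exists_min nat (fun=> True) f; first by exists 0.
by apply: (fP i i.+1) => //; apply: min_i.
Qed.

Lemma wqo_fin_eq (F : finType) : wqo (fun x y : F => x = y).
Proof.
apply: nbad_wqo => [x y z -> //|f fP].
have /leq_card : injective (fun i : 'I_#|F|.+1 => f i).
  move=> i j eq_f; apply: val_inj; case: (ltngtP i j) => // lt_ij.
    by case: (fP _ _ lt_ij).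
  by case: (fP _ _ lt_ij).
by rewrite card_ord ltnn.
Qed.

Lemma dickson (I : finType) :
  wqo (fun m n : {ffun I -> nat} => forall i, m i <= n i).
Proof.
suff w (s : seq I) :
    wqo (fun m n : {ffun I -> nat} => forall i, i \in s -> m i <= n i).
  by apply: sub_wqo (w (enum I)) => m n le_mn i; apply: le_mn; rewrite mem_enum.
elim: s => [|i s IHs].
  by move=> f; exists id; split=> // i j _ l; rewrite in_nil.
apply: sub_wqo (wqo_and IHs (wqo_preim (fun m : {ffun I -> nat} => m i) wqo_nat)).
move=> m n [le_s le_i] j.
by rewrite inE => /predU1P[-> // | /le_s].
Qed.

(** Nash-Williams' construction: place by place, the current bad sequence is replaced by a bad one
    with the same earlier entries and an entry of least measure at this place. Each initial segment
    of the diagonal is one of a bad sequence. *)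
Lemma minimal_bad A (r : A -> A -> Prop) (m : A -> nat) :
  (exists f, bad r f) ->
  exists f, bad r f /\ forall g n, bad r g -> (forall i, i < n -> g i = f i) ->
    m (f n) <= m (g n).
Proof.
case=> f0 f0P.
have stepP (p : nat * (nat -> A)) : exists g, bad r p.2 ->
    [/\ bad r g, forall i, i < p.1 -> g i = p.2 i
      & forall g', bad r g' -> (forall i, i < p.1 -> g' i = p.2 i) ->
          m (g p.1) <= m (g' p.1)].
  case: (classic (bad r p.2)) => [badp|]; last by exists f0.
  have [|g [[bad_g eq_g] min_g]] := @exists_min _
    (fun g => bad r g /\ forall i, i < p.1 -> g i = p.2 i) (fun g => m (g p.1)).
    by exists p.2.
  by exists g => _; split=> // g' bad_g' eq_g'; apply: min_g.
have {stepP}[step stepP] := choice_fun stepP.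
(* In [G n] the first [n] entries are final. *)
pose G := fix G n := if n is n'.+1 then step (n', G n') else f0.
have GP n : bad r (G n) by elim: n => //= n /(stepP (n, _))[].
have Gstep n i : i < n -> G n.+1 i = G n i.
  by move=> lt_in; have [_ eqG _] := stepP (n, G n) (GP n); apply: eqG.
have Gle n i d : i < n -> G (d + n) i = G n i.
  by move=> lt_in; elim: d => // d IHd; rewrite addSn Gstep ?IHd // ltn_addl.
have Gf n i : i < n -> G n i = G i.+1 i.
  by move=> lt_in; rewrite -(subnK lt_in) Gle.
exists (fun n => G n.+1 n); split=> [i j lt_ij|g n bad_g eq_g].
  by rewrite -(Gf j.+1 i) ?(ltn_trans lt_ij) //; apply: GP.
have [_ _ /=] := stepP (n, G n) (GP n); apply=> // i lt_in.
by rewrite eq_g // Gf.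
Qed.

(** * Kruskal's theorem for labelled binary trees *)

Inductive tree (L : Type) := Leaf of L | Node of bool & tree L & tree L.
Arguments Leaf {L}.
Arguments Node {L}.

Fixpoint tree_size L (t : tree L) : nat :=
  if t is Node _ t1 t2 then (tree_size t1 + tree_size t2).+1 else 1.

Section Kruskal.
Variables (L : Type) (r : L -> L -> Prop).

(** Nodes go to nodes with the same mark, left subtree to left subtree: for cotrees this preserves
    both adjacency and the order of the leaves. *)
Fixpoint tree_emb (s t : tree L) : Prop :=
  match t with
  | Leaf y => if s is Leaf x then r x y else False
  | Node c t1 t2 => tree_emb s t1 \/ tree_emb s t2 \/
      (if s is Node b s1 s2 then [/\ b = c, tree_emb s1 t1 & tree_emb s2 t2]
       else False)
  end.

Hypothesis r_trans : forall x y z, r x y -> r y z -> r x z.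

Lemma tree_emb_trans s t u : tree_emb s t -> tree_emb t u -> tree_emb s u.
Proof.
elim: u s t => [z|c u1 IH1 u2 IH2] s t.
  by case: t => // y; case: s => // x; apply: r_trans.
move=> st /= [tu1|[tu2|]]; first by left; apply: IH1 st tu1.
  by right; left; apply: IH2 st tu2.
case: t st => [//|b t1 t2] /= st [bc tu1 tu2]; case: st => [st1|[st2|]].
- by left; apply: IH1 tu1.
- by right; left; apply: IH2 tu2.
case: s => // a s1 s2 [ab st1 st2]; right; right.
by split; [rewrite ab | apply: IH1 tu1 | apply: IH2 tu2].
Qed.

Definition child (s t : tree L) :=
  if t is Node _ t1 t2 then s = t1 \/ s = t2 else False.

Lemma child_size s t : child s t -> tree_size s < tree_size t.
Proof.
by case: t => [//|b t1 t2] /= [] ->; rewrite ltnS ?leq_addr ?leq_addl.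
Qed.

Lemma child_emb s t u : child t u -> tree_emb s t -> tree_emb s u.
Proof. case: u => [//|b u1 u2] /= [] -> st; by [left | right; left]. Qed.

Hypothesis r_wqo : wqo r.

(** In a minimal bad sequence the children of the entries are well-quasi-ordered, being smaller than
    the entries. Infinitely many leaves would contradict the order on labels; in a tail without
    leaves, comparing marks and both children gives a good pair. *)
Theorem kruskal : wqo tree_emb.
Proof.
apply: nbad_wqo => [x y z|f0 bad_f0]; first exact: tree_emb_trans.
have [|f [bad_f min_f]] := @minimal_bad _ tree_emb (@tree_size L).
  by exists f0.
have children_wqo :
    wqo (fun s t : {s | exists i, child s (f i)} => tree_emb (sval s) (sval t)).
  apply: nbad_wqo => [x y z|g bad_g]; first exact: tree_emb_trans.
  have /choice_fun[h hP] : forall n, exists i, child (sval (g n)) (f i).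
    by move=> n; case: (g n).
  (* All entries of [g] have parents of index at least [h n], so a tree before [h n] that embeds
     into such a child would embed into a later tree of [f]. *)
  have [|n [_ min_n]] := @exists_min nat (fun=> True) h; first by exists 0.
  (* Splicing the children [g n, g n.+1, ...] into [f] at index [h n] keeps it
     bad and makes its entry at [h n] smaller. *)
  pose f' i := if i < h n then f i else sval (g (i - h n + n)).
  have bad_f' : bad tree_emb f'.
    rewrite /f' => i j lt_ij; case: ltnP => [lt_ih | le_hi].
      case: ltnP => [_|le_hj]; first exact: bad_f.
      move/(child_emb (hP _)); apply: bad_f; apply: leq_trans lt_ih _.
      exact: min_n.
    rewrite ltnNge (leq_trans le_hi (ltnW lt_ij)) /=; apply: bad_g.
    by rewrite ltn_add2r ltn_sub2r // (leq_ltn_trans le_hi).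
  have := min_f f' (h n) bad_f'.
  rewrite [f' (h n)]/f' ltnn subnn add0n leqNgt child_size // => min_h.
  by have /min_h : forall i, i < h n -> f' i = f i by move=> i lt_i; rewrite /f' lt_i.
case: (classic (forall n, exists i, n <= i /\ exists x, f i = Leaf x)) => [|no_leaf].
  case/infinite_enum=> h [hP /choice_fun[x xP]].
  apply: (wqo_nbad (f := x) r_wqo) => i j /hP lt_h rij.
  by apply: (bad_f _ _ lt_h); rewrite !xP.
have [N NP] : exists N, forall i, N <= i -> ~ exists x, f i = Leaf x.
  apply: NNPP => noN; apply: no_leaf => n; apply: NNPP => noi; apply: noN.
  by exists n => i le_ni xP; apply: noi; exists i.
have /choice_fun[q qP] : forall i, exists q : bool * tree L * tree L,
    f (N + i) = Node q.1.1 q.1.2 q.2.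
  move=> i; case: (f (N + i)) (NP _ (leq_addr i N)) => [x []|b s t _].
    by exists x.
  by exists (b, s, t).
have c1 i : exists k, child (q i).1.2 (f k) by exists (N + i); rewrite qP; left.
have c2 i : exists k, child (q i).2 (f k) by exists (N + i); rewrite qP; right.
have w := wqo_and (wqo_and
  (wqo_preim (fun i => exist _ _ (c1 i) : {s | exists i, child s (f i)}) children_wqo)
  (wqo_preim (fun i => exist _ _ (c2 i) : {s | exists i, child s (f i)}) children_wqo))
  (wqo_preim (fun i => (q i).1.1) (@wqo_fin_eq bool)).
apply: (wqo_nbad w (f := id)) => i j lt_ij [[/= e1 e2] e3].
apply: (bad_f (N + i) (N + j)); first by rewrite ltn_add2l.
by rewrite !qP; right; right.
Qed.

End Kruskal.

(** * Cotrees *)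

Section MakeEmbedding.
Variables (G H : sgraph) (f : G -> H).
Hypotheses (f_inj : injective f) (f_adj : forall x y, adj (f x) (f y) = adj x y).

Fact mk_emb_subproof : full_embedding [ffun x => f x].
Proof.
apply/andP; split; first by apply/injectiveP => x y; rewrite !ffunE; apply: f_inj.
by apply/forallP => x; apply/forallP => y; rewrite !ffunE f_adj.
Qed.

Definition mk_emb : embedding G H := Sub _ mk_emb_subproof.

Lemma mk_embE x : mk_emb x = f x.
Proof. by rewrite /emb_fun SubK ffunE. Qed.

End MakeEmbedding.

Lemma id_embE (G : sgraph) (x : G) : id_emb G x = x.
Proof. by rewrite /emb_fun SubK ffunE. Qed.

Lemma comp_embE (G H K : sgraph) (g : embedding H K) (f : embedding G H) x :
  comp_emb g f x = g (f x).
Proof. by rewrite {1}/emb_fun SubK ffunE. Qed.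

Lemma embP (G H : sgraph) (f g : embedding G H) : f =1 g -> f = g.
Proof. by move=> fg; apply/val_inj/ffunP. Qed.

Lemma emb_inv (G H : sgraph) (f : embedding G H) : bijective f ->
  exists g : embedding H G, comp_emb f g = id_emb H.
Proof.
case=> g fK gK; have g_adj x y : adj (g x) (g y) = adj x y.
  by rewrite -[in RHS](gK x) -[in RHS](gK y) emb_adj.
exists (mk_emb (can_inj gK) g_adj); apply: embP => x.
by rewrite comp_embE id_embE mk_embE.
Qed.

Section Cotree.

Definition point_graph : sgraph.
Proof. by exists unit (fun _ _ => false). Defined.

Section Sum.
Variables (b : bool) (G H : sgraph).

Definition sum_adj : rel (vertex G + vertex H) := fun x y =>
  match x, y with
  | inl u, inl v => adj u v
  | inr u, inr v => adj u v
  | _, _ => b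
  end.

Fact sum_sym : symmetric sum_adj.
Proof. by case=> u [] v //=; apply: adj_sym. Qed.

Fact sum_irr : irreflexive sum_adj.
Proof. by case=> u /=; apply: adj_irr. Qed.

Definition sum_graph := SGraph sum_sym sum_irr.

End Sum.

(** A node marked [false] is a disjoint union, one marked [true] a join. *)
Fixpoint tree_graph (T : tree unit) : sgraph :=
  match T with
  | Leaf _ => point_graph
  | Node b T1 T2 => sum_graph b (tree_graph T1) (tree_graph T2)
  end.

Lemma tree_graph_cograph T : is_cograph (tree_graph T).
Proof.
elim: T => [x|[] T1 G1 T2 G2] /=; first 1 last.
(* A join is the complement of the union of the complements, on the same vertex type, so the
   isomorphism is the identity. *)
- have := cograph_compl (cograph_union (cograph_compl G1) (cograph_compl G2)).
  set G := edge_complement _; pose f (x : G) : tree_graph (Node true T1 T2) := x.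
  have f_inj : injective f by move=> x y.
  have f_adj x y : adj (f x) (f y) = adj x y.
    case: x y => x [] y //=; rewrite /compl_adj /= /compl_adj.
      rewrite (inj_eq (@inl_inj _ _)) negb_and !negbK andb_orr andNb.
      by case: eqP => //= ->; rewrite adj_irr.
    rewrite (inj_eq (@inr_inj _ _)) negb_and !negbK andb_orr andNb.
    by case: eqP => //= ->; rewrite adj_irr.
  apply: (@cograph_iso _ _ (mk_emb f_inj f_adj)).
  by exists id => x; rewrite mk_embE.
- have := cograph_union G1 G2.
  set G := disjoint_union _ _; pose f (x : G) : tree_graph (Node false T1 T2) := x.
  have f_inj : injective f by move=> x y.
  have f_adj x y : adj (f x) (f y) = adj x y by case: x y => x [].
  apply: (@cograph_iso _ _ (mk_emb f_inj f_adj)).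
  by exists id => x; rewrite mk_embE.
- by apply: cograph_single; rewrite card_unit.
Qed.

Definition tree_cograph T := Cograph (tree_graph_cograph T).

Fixpoint tree_compl L (T : tree L) : tree L :=
  if T is Node b T1 T2 then Node (~~ b) (tree_compl T1) (tree_compl T2) else T.

(** De Morgan: swapping unions and joins complements the graph. The two vertex types have the same
    shape but are not convertible for a variable [T], hence the bijection. *)
Lemma tree_compl_graph T : exists f : tree_graph (tree_compl T) -> tree_graph T,
  bijective f /\ forall x y, adj (f x) (f y) = (x != y) && ~~ adj x y.
Proof.
elim: T => [x|b T1 [f1 [bij1 f1P]] T2 [f2 [bij2 f2P]]] /=.
  by exists id; split; [exists id | case=> []].
exists (fun x => match x with inl u => inl (f1 u) | inr u => inr (f2 u) end).
split.
  case: bij1 bij2 => g1 f1K g1K [g2 f2K g2K].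
  by exists (fun x => match x with inl u => inl (g1 u) | inr u => inr (g2 u) end);
    case=> x; rewrite ?f1K ?f2K ?g1K ?g2K.
by case=> x [] y /=; rewrite ?f1P ?f2P ?negbK.
Qed.

Lemma cograph_tree (G : sgraph) : is_cograph G ->
  exists (T : tree unit) (f : embedding (tree_graph T) G), bijective f.
Proof.
elim=> {G} [G cG | G H _ [T1 [f1 bij1]] _ [T2 [f2 bij2]]
  | G _ [T [f bij_f]] | G H f bij_f _ [T [g bij_g]]].
- have [x xP] : exists x : G, forall y, y = x.
    have /card_gt0P[x _] : 0 < #|G| by rewrite cG.
    by exists x => y; have /fintype_le1P/(_ x)-> : #|G| <= 1 by rewrite cG.
  pose f (_ : tree_graph (Leaf tt)) : G := x.
  have f_inj : injective f by case=> [] [].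
  have f_adj u v : adj (f u) (f v) = adj u v by rewrite adj_irr.
  exists (Leaf tt), (mk_emb f_inj f_adj).
  by exists (fun=> tt) => y; [case: y | rewrite mk_embE [y]xP].
- case: bij1 bij2 => g1 f1K g1K [g2 f2K g2K].
  pose f (x : tree_graph (Node false T1 T2)) : disjoint_union G H :=
    match x with inl u => inl (f1 u) | inr u => inr (f2 u) end.
  pose g (x : disjoint_union G H) : tree_graph (Node false T1 T2) :=
    match x with inl u => inl (g1 u) | inr u => inr (g2 u) end.
  have fK : cancel f g by case=> x /=; rewrite ?f1K ?f2K.
  have gK : cancel g f by case=> x /=; rewrite ?g1K ?g2K.
  have f_adj x y : adj (f x) (f y) = adj x y.
    by case: x y => x [] y //=; rewrite emb_adj.
  exists (Node false T1 T2), (mk_emb (can_inj fK) f_adj).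
  by exists g => x; rewrite mk_embE.
- have [h [bij_h hP]] := tree_compl_graph T.
  pose f' (x : tree_graph (tree_compl T)) : edge_complement G := f (h x).
  have f'_inj : injective f' := inj_comp (@emb_inj _ _ f) (bij_inj bij_h).
  have f'_adj x y : adj (f' x) (f' y) = adj x y.
    rewrite /= /compl_adj (inj_eq f'_inj).
    by rewrite emb_adj hP; case: eqP => [->|_] /=; rewrite ?adj_irr ?negbK.
  exists (tree_compl T), (mk_emb f'_inj f'_adj).
  case: bij_f bij_h => k fK kK [l hK lK].
  by exists (l \o k) => x /=; rewrite mk_embE /f' ?fK ?hK // lK kK.
exists T, (comp_emb f g); case: bij_f bij_g => k fK kK [l gK lK].
by exists (l \o k) => x /=; rewrite comp_embE ?fK ?gK // lK kK.
Qed.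

(** Nonemptiness lets the labels of a term reveal which generator it comes from. *)
Lemma cograph_vertex (G : sgraph) : is_cograph G -> exists x : G, true.
Proof.
case/cograph_tree=> T [f _]; suff [x _] : exists x : tree_graph T, true by exists (f x).
by elim: T {f} => [t|b T1 [x _] T2 _] /=; [exists tt | exists (inl x)].
Qed.

Fixpoint leaf_rank (T : tree unit) : tree_graph T -> nat :=
  match T return tree_graph T -> nat with
  | Leaf _ => fun=> 0
  | Node _ T1 T2 => fun x =>
      match x with
      | inl u => leaf_rank u
      | inr u => tree_size T1 + leaf_rank u
      end
  end.

Lemma leaf_rank_lt T (x : tree_graph T) : leaf_rank x < tree_size T.
Proof.
elim: T x => [t|b T1 IH1 T2 IH2] //= [] x.
  by rewrite ltnS ltnW // ltn_addr.
by rewrite ltnS ltnW // ltn_add2l.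
Qed.

Lemma leaf_rank_inj T : injective (@leaf_rank T).
Proof.
elim: T => [x|b T1 IH1 T2 IH2] /=; first by case=> [] [].
case=> x [] y.
- by move=> /IH1->.
- by move=> eq_xy; have := leaf_rank_lt x; rewrite eq_xy ltnNge leq_addr.
- by move=> eq_xy; have := leaf_rank_lt y; rewrite -eq_xy ltnNge leq_addr.
by move/addnI => /IH2->.
Qed.

Variables (L : Type) (r : L -> L -> Prop).

Fixpoint relabel (T : tree unit) : (tree_graph T -> L) -> tree L :=
  match T return (tree_graph T -> L) -> tree L with
  | Leaf _ => fun e => Leaf (e tt)
  | Node b T1 T2 => fun e =>
      Node b (relabel (fun x => e (inl x))) (relabel (fun x => e (inr x)))
  end.

(** Adjacency of two leaves is the mark at their lowest common ancestor, and their order is given by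
    the sides on which they lie below it; a tree embedding preserves both. *)
Lemma tree_emb_embedding T T' (e : tree_graph T -> L) (e' : tree_graph T' -> L) :
  tree_emb r (relabel e) (relabel e') ->
  exists phi : embedding (tree_graph T) (tree_graph T'),
    (forall u v, leaf_rank u < leaf_rank v -> leaf_rank (phi u) < leaf_rank (phi v))
    /\ forall v, r (e v) (e' (phi v)).
Proof.
elim: T' T e e' => [y|c A IHA B IHB] T e e' /=.
  case: T e => [x|//] e /= rxy; exists (id_emb point_graph).
  by split=> [u v //|[]]; rewrite id_embE.
case=> [/IHA[phi [rk le]] | [/IHB[phi [rk le]] |]].
- pose f x : tree_graph (Node c A B) := inl (phi x).
  have f_inj : injective f by move=> x y [/emb_inj].
  have f_adj x y : adj (f x) (f y) = adj x y by rewrite /= emb_adj.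
  by exists (mk_emb f_inj f_adj); split=> *; rewrite !mk_embE //=; apply: rk.
- pose f x : tree_graph (Node c A B) := inr (phi x).
  have f_inj : injective f by move=> x y [/emb_inj].
  have f_adj x y : adj (f x) (f y) = adj x y by rewrite /= emb_adj.
  exists (mk_emb f_inj f_adj); split=> *; rewrite !mk_embE //= ltn_add2l.
  exact: rk.
case: T e => // b T1 T2 e /= [-> /IHA[f1 [rk1 le1]] /IHB[f2 [rk2 le2]]].
pose f (x : tree_graph (Node c T1 T2)) : tree_graph (Node c A B) :=
  match x with inl u => inl (f1 u) | inr u => inr (f2 u) end.
have f_inj : injective f by case=> x [] y //= [/emb_inj->].
have f_adj x y : adj (f x) (f y) = adj x y.
  by case: x y => x [] y //=; rewrite emb_adj.
exists (mk_emb f_inj f_adj); split=> [u v|[] v]; rewrite !mk_embE //.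
case: u v => u [] v /=.
- exact: rk1.
- by move=> _; rewrite ltn_addr ?leaf_rank_lt.
- by rewrite ltnNge (leq_trans (ltnW (leaf_rank_lt _)) (leq_addr _ _)).
by rewrite !ltn_add2l; apply: rk2.
Qed.

End Cotree.

(** * Polynomials and transition maps *)

Local Open Scope ring_scope.

Section MonomialAlgebra.
Variables (k : comNzRingType) (I : finType).
Implicit Type p : {malg k[{cmonom I}]}.

Lemma mkmalgM (m n : {cmonom I}) :
  << mmul m n >> = << m >> * << n >> :> {malg k[{cmonom I}]}.
Proof. by rewrite malgM_def fgmulUU mulr1. Qed.

Lemma mkmalg_prod (m : {cmonom I}) :
  << m >> = \prod_i << ucm i >> ^+ m i :> {malg k[{cmonom I}]}.
Proof.
have powE (i : I) n : exists2 u : {cmonom I},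
    << ucm i >> ^+ n = << u >> :> {malg k[{cmonom I}]}
    & forall j, u j = (n * (i == j))%N.
  elim: n => [|n [u uE uP]].
    by exists mone => [|j]; rewrite ?expr0 // cm1.
  exists (mmul (ucm i) u) => [|j]; first by rewrite exprS uE mkmalgM.
  by rewrite cmM cmU uP mulSn.
have prodE (s : seq I) : exists2 u : {cmonom I},
    \prod_(i <- s) << ucm i >> ^+ m i = << u >> :> {malg k[{cmonom I}]}
    & forall j, u j = (\sum_(i <- s) m i * (i == j))%N.
  elim: s => [|i s [u uE uP]].
    by exists mone => [|j]; rewrite big_nil // cm1.
  have [v vE vP] := powE i (m i).
  exists (mmul v u) => [|j]; first by rewrite big_cons uE vE mkmalgM.
  by rewrite big_cons cmM vP uP.
have [u -> uP] := prodE (index_enum I); congr << _ >>.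
apply/eqP/cmP => j; rewrite uP (bigD1 j) //= eqxx muln1 big1 ?addn0 //.
by move=> i /negPf->; rewrite muln0.
Qed.

Lemma malg_ind (P : {malg k[{cmonom I}]} -> Prop) :
  P 0 ->
  (forall a (m : {ffun I -> nat}) p, P p ->
    P (a%:MP * (\prod_i << ucm i >> ^+ m i) + p)) ->
  forall p, P p.
Proof.
move=> P0 PD p; rewrite [p]monalgE; elim: (enum_fset _) => [|m s IHs].
  by rewrite big_nil.
rewrite big_cons.
have -> : << p@_m *g m >> = (p@_m)%:MP * (\prod_i << ucm i >> ^+ [ffun i => m i] i).
  under eq_bigr do rewrite ffunE.
  by rewrite -mkmalg_prod malgM_def fgmulUU mulr1 mul1m.
exact: PD.
Qed.

End MonomialAlgebra.

Lemma prod_fibers (R : comNzRingType) (I J : finType) (h : I -> J) (X : J -> R)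
    (m : I -> nat) :
  \prod_j X j ^+ (\sum_(i | h i == j) m i) = \prod_i X (h i) ^+ m i.
Proof.
rewrite [RHS](partition_big h predT) //=; apply: eq_bigr => j _.
by rewrite -prodrXr; apply: eq_bigr => i /eqP <-.
Qed.

Section Monomials.
Variables (k : comNzRingType) (c : nat).

Definition mon (G : sgraph) (m : {ffun G * 'I_c -> nat}) : tensor_poly k c G :=
  \prod_p polyvar k p.1 p.2 ^+ m p.

Lemma poly_ind (G : sgraph) (P : tensor_poly k c G -> Prop) :
  P 0 -> (forall a m p, P p -> P (polyconst c G a * mon m + p)) -> forall p, P p.
Proof.
move=> P0 PD; apply: (@malg_ind k (G * 'I_c)%type P P0) => a m p Pp.
have <- : mon m = \prod_i << ucm i >> ^+ m i by apply: eq_bigr => -[].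
exact: PD.
Qed.

Lemma monD (G : sgraph) (m n : {ffun G * 'I_c -> nat}) :
  mon [ffun p => m p + n p]%N = mon m * mon n.
Proof.
by rewrite /mon -big_split; apply: eq_bigr => p _; rewrite ffunE exprD.
Qed.

Lemma mon0 (G : sgraph) : mon [ffun=> 0%N] = 1 :> tensor_poly k c G.
Proof. by rewrite /mon big1 // => p _; rewrite ffunE expr0. Qed.

(** The exponents of the image monomial: as [f] is injective, each sum has at most one term. *)
Definition push (G H : sgraph) (f : embedding G H) (m : {ffun G * 'I_c -> nat}) :
  {ffun H * 'I_c -> nat} :=
  [ffun q => \sum_(p | (f p.1, p.2) == q) m p]%N.

Lemma push_emb (G H : sgraph) (f : embedding G H) m v i : push f m (f v, i) = m (v, i).
Proof.
rewrite ffunE (big_pred1 (v, i)) // => -[u j] /=.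
by rewrite !xpair_eqE (inj_eq (@emb_inj _ _ f)).
Qed.

Lemma push_out (G H : sgraph) (f : embedding G H) m v i :
  (forall u, f u != v) -> push f m (v, i) = 0%N.
Proof.
move=> vP; rewrite ffunE big_pred0 // => -[u j] /=.
by rewrite xpair_eqE (negPf (vP u)).
Qed.

Lemma mon_push (G H : sgraph) (f : embedding G H) m :
  mon (push f m) = \prod_p polyvar k (f p.1) p.2 ^+ m p.
Proof.
rewrite -(prod_fibers (fun p : G * 'I_c => (f p.1, p.2)) (fun q => polyvar k q.1 q.2)).
by apply: eq_bigr => q _; rewrite ffunE.
Qed.

End Monomials.

Arguments mon {k c G} m.

Section Transition.
Variables (k : comNzRingType) (c : nat) (V : amodule k c).
Implicit Types G H : cograph.
Local Notation pc G := (@polyconst k c G).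

Lemma polyconst0 (G : sgraph) : pc G 0 = 0.
Proof. exact: malgC0E. Qed.

Lemma polyconst1 (G : sgraph) : pc G 1 = 1.
Proof. exact: mpolyC1E. Qed.

Lemma polyconstD (G : sgraph) a b : pc G (a + b) = pc G a + pc G b.
Proof. exact: monalgUD. Qed.

Lemma polyconstN (G : sgraph) a : pc G (- a) = - pc G a.
Proof. exact: monalgUN. Qed.

Lemma polyconstM (G : sgraph) a b : pc G (a * b) = pc G a * pc G b.
Proof. exact: mpolyCM. Qed.

Lemma transD G H (f : embedding G H) (x y : V G) :
  trans f (x + y) = trans f x + trans f y.
Proof.
by have := trans_linear f 1 x y; rewrite !polyconst1 !scale1r.
Qed.

Lemma trans0 G H (f : embedding G H) : trans f (0 : V G) = 0.
Proof. by apply: (addrI (trans f 0)); rewrite -transD !addr0. Qed.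

Lemma transZ G H (f : embedding G H) a (x : V G) :
  trans f (pc G a *: x) = pc H a *: trans f x.
Proof. by have := trans_linear f a x 0; rewrite trans0 !addr0. Qed.

Lemma trans_mon G H (f : embedding G H) m (x : V G) :
  trans f (mon m *: x) = mon (push f m) *: trans f x.
Proof.
have powE v i n (y : V G) :
    trans f (polyvar k v i ^+ n *: y) = polyvar k (f v) i ^+ n *: trans f y.
  elim: n y => [|n IHn] y; first by rewrite !expr0 !scale1r.
  by rewrite !exprS -!scalerA trans_var IHn.
rewrite mon_push /mon; elim: (index_enum _) x => [|p s IHs] x.
  by rewrite !big_nil !scale1r.
by rewrite !big_cons -!scalerA powE IHs.
Qed.

(** The axioms only speak of constants and variables; by induction on [p], the [q] constructed is
    [p] with its variables renamed along [f]. *)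
Lemma trans_semilinear G H (f : embedding G H) (p : tensor_poly k c G) :
  exists q : tensor_poly k c H, forall x : V G, trans f (p *: x) = q *: trans f x.
Proof.
elim/poly_ind: p => [|a m p [q qE]].
  by exists 0 => x; rewrite !scale0r trans0.
exists (pc H a * mon (push f m) + q) => x.
by rewrite !scalerDl -!scalerA transD transZ trans_mon qE.
Qed.

End Transition.

(** * Terms and leading terms *)

Section LexOrder.
Variables (P : finType) (rk : P -> nat).
Hypothesis rk_inj : injective rk.
Implicit Types e : {ffun P -> nat}.

Definition lex e e' :=
  exists p, (e p < e' p)%N /\ forall q, (rk q < rk p)%N -> e q = e' q.

Lemma lex_trans e1 e2 e3 : lex e1 e2 -> lex e2 e3 -> lex e1 e3.
Proof.
case=> p [lt_p eq_p] [q [lt_q eq_q]].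
case: (ltngtP (rk p) (rk q)) => [lt_pq|lt_qp|/rk_inj eq_pq].
- exists p; split=> [|r lt_rp]; first by rewrite -eq_q.
  by rewrite eq_p // eq_q // (ltn_trans lt_rp).
- exists q; split=> [|r lt_rq]; first by rewrite eq_p.
  by rewrite eq_p ?eq_q // (ltn_trans lt_rq).
exists p; rewrite -{}eq_pq in lt_q eq_q.
split=> [|r lt_rp]; first exact: ltn_trans lt_q.
by rewrite eq_p ?eq_q.
Qed.

Lemma lex_irr e : ~ lex e e.
Proof. by case=> p []; rewrite ltnn. Qed.

Lemma lex_total e e' : e <> e' -> lex e e' \/ lex e' e.
Proof.
move=> ne; have [p pP] : exists p, e p != e' p.
  apply/existsP; rewrite -negb_forall; apply/negP => /forallP eq_e.
  by apply: ne; apply/ffunP => p; apply/eqP.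
have [|q [/negP nq min_q]] := @exists_min _ (fun p => ~~ (e p == e' p)) rk.
  by exists p.
have eq_q r : (rk r < rk q)%N -> e r = e' r.
  by move=> lt_rq; apply/eqP/negPn/negP => /min_q; rewrite leqNgt lt_rq.
case: (ltngtP (e q) (e' q)) => [lt|lt|/eqP //]; [left | right]; exists q.
  by split=> // r /eq_q.
by split=> // r /eq_q.
Qed.

(** Well-foundedness in the form of minima: the coordinates are minimised one rank after the other,
    each time among the elements already minimal at the smaller ranks. *)
Lemma lex_min D (code : D -> {ffun P -> nat}) (Q : D -> Prop) :
  (exists d, Q d) -> exists d, Q d /\ forall d', Q d' -> ~ lex (code d') (code d).
Proof.
move=> Q0.
(* Invariant: every competitor of [d] agrees with it on the ranks below [n] or is larger. *)
have minP n : exists d, Q d /\ forall d', Q d' ->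
    (forall q, (rk q < n)%N -> code d' q = code d q) \/ lex (code d) (code d').
  elim: n => [|n [d [Qd dP]]]; first by case: Q0 => d Qd; exists d; split=> //; left.
  pose R d' := Q d' /\ forall q, (rk q < n)%N -> code d' q = code d q.
  case: (pickP (fun p => rk p == n)) => [p /eqP rk_p|no_p].
    have [|d1 [[Qd1 eq1] min1]] := @exists_min _ R (fun d => code d p).
      by exists d.
    exists d1; split=> // d' Qd'; case: (dP d' Qd') => [eq'|lt_dd'].
      have := min1 d' (conj Qd' eq'); rewrite leq_eqVlt => /predU1P[eq_p|lt_p].
        left=> q; rewrite ltnS leq_eqVlt -rk_p => /predU1P[/rk_inj-> //|].
        by rewrite rk_p => lt_q; rewrite eq1 ?eq'.
      by right; exists p; split=> // q; rewrite rk_p => lt_q; rewrite eq1 ?eq'.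
    case: lt_dd' => q [lt_q eq_q]; case: (ltnP (rk q) n) => [lt_qn|le_nq].
      right; exists q; split=> [|r lt_rq]; first by rewrite eq1.
      by rewrite eq1 ?eq_q // (ltn_trans lt_rq).
    have eq' r : (rk r < n)%N -> code d' r = code d r.
      by move=> lt_rn; rewrite eq_q // (leq_trans lt_rn).
    have := min1 d' (conj Qd' eq'); rewrite leq_eqVlt => /predU1P[eq_p|lt_p].
      left=> r; rewrite ltnS leq_eqVlt -rk_p => /predU1P[/rk_inj-> //|].
      by rewrite rk_p => lt_r; rewrite eq1 ?eq'.
    by right; exists p; split=> // r; rewrite rk_p => lt_r; rewrite eq1 ?eq'.
  exists d; split=> // d' /dP[eq'|]; [left=> q | by right].
  by rewrite ltnS leq_eqVlt no_p; apply: eq'.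
(* All ranks lie below this bound, so a competitor that agrees with [d] there has the same code. *)
have [d [Qd dP]] := minP (\max_p rk p).+1; exists d; split=> // d' Qd' lt_d'd.
case: (dP d' Qd') => [eq_d|/lex_trans/(_ lt_d'd)/lex_irr //].
have eq_code : code d' = code d.
  by apply/ffunP => p; apply: eq_d; rewrite ltnS; apply: leq_bigmax.
by move: lt_d'd; rewrite eq_code => /lex_irr.
Qed.

End LexOrder.

(** The ideal generated by all the [a i] has finitely many generators, which already lie in the span
    of the first [n] for some [n]. *)
Lemma noetherian_acc (k : comNzRingType) (a : nat -> k) : noetherian_ring k ->
  exists n, generated (fun y : k^o => exists i, (i < n)%N /\ y = a i) (a n).
Proof.
pose S n (y : k^o) := exists i, (i < n)%N /\ y = a i.
have genW m n x : (m <= n)%N -> generated (S m) x -> generated (S n) x.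
  move=> le_mn gx N subN SN; apply: gx => // y [i [lt_im ->]]; apply: SN.
  by exists i; rewrite (leq_trans lt_im).
move=> /(_ (fun x => exists n, generated (S n) x))[].
  split=> [|b x y [m gx] [n gy]]; first by exists 0%N => N [].
  exists (maxn m n) => N subN SN.
  by apply: (proj2 subN); [apply: genW gx N subN SN; apply: leq_maxl
    | apply: genW gy N subN SN; apply: leq_maxr].
move=> s sP; have [n nP] : exists n, forall x, x \in s -> generated (S n) x.
  have: forall x, x \in s -> exists n, generated (S n) x.
    by move=> x xs; apply/sP => N _; apply.
  elim: s {sP} => [|x s IHs] sP; first by exists 0%N.
  have [m mP] := sP x (mem_head _ _).
  have [|n nP] := IHs; first by move=> y ys; apply: sP; rewrite inE ys orbT.
  exists (maxn m n) => y; rewrite inE => /predU1P[->|/nP].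
    exact: genW (leq_maxl _ _) mP.
  exact: genW (leq_maxr _ _).
exists n => N subN SN.
have /sP : exists m, generated (S m) (a n).
  by exists n.+1 => N' _; apply; exists n.
by apply=> // y /nP; apply.
Qed.

Section Submodules.
Variables (R : nzRingType) (M : lmodType R).
Implicit Types N S : M -> Prop.

Lemma submoduleZ N a x : is_submodule N -> N x -> N (a *: x).
Proof. by case=> N0 ND Nx; rewrite -[_ *: _]addr0; apply: ND. Qed.

Lemma submoduleD N x y : is_submodule N -> N x -> N y -> N (x + y).
Proof. by case=> N0 ND Nx Ny; rewrite -[x]scale1r; apply: ND. Qed.

Lemma submoduleB N x y : is_submodule N -> N x -> N y -> N (x - y).
Proof. by case=> N0 ND Nx Ny; rewrite addrC -scaleN1r; apply: ND. Qed.

Lemma generated_submodule S : is_submodule (generated S).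
Proof.
split=> [N [] //|a x y gx gy N subN SN].
by apply: (proj2 subN); [apply: gx | apply: gy].
Qed.

Lemma generated_mem S x : S x -> generated S x.
Proof. by move=> Sx N _; apply. Qed.

Lemma generated_sub S N x : is_submodule N -> (forall y, S y -> N y) ->
  generated S x -> N x.
Proof. by move=> subN SN; apply. Qed.

End Submodules.

Lemma scale_lin_comb (R : nzRingType) (M : lmodType R) (a b d : R) (v x y : M) :
  a *: (b *: v + x) + (d *: v + y) = (a * b + d) *: v + (a *: x + y).
Proof. by rewrite scalerDr scalerA scalerDl addrACA. Qed.

Section Terms.
Variables (k : comNzRingType) (c : nat) (V : amodule k c).
Variables (J : finType) (Gs : J -> cograph) (vs : forall j, V (Gs j)).
Local Notation pc G := (@polyconst k c G).

Definition term (G : sgraph) : Type :=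
  ({j : J & embedding (Gs j) G} * {ffun G * 'I_c -> nat})%type.

Definition term_val (G : cograph) (d : term G) : V G :=
  mon d.2 *: trans (tagged d.1) (vs (tag d.1)).

(** The multiple x^m f_*(d); divisibility of terms means being of this form. *)
Definition term_act (G H : sgraph) (f : embedding G H) (m : {ffun H * 'I_c -> nat})
    (d : term G) : term H :=
  (Tagged (fun j => embedding (Gs j) H) (comp_emb f (tagged d.1)),
   [ffun p => m p + push f d.2 p]%N).

Lemma term_val_act (G H : cograph) (f : embedding G H) m d :
  term_val (term_act f m d) = mon m *: trans f (term_val d).
Proof. by rewrite /term_val /= monD -scalerA trans_mon trans_comp. Qed.

(** Coefficients are constants only, as variables belong to the terms; [P] will serve to bound the
    terms from above. *)
Inductive kspan (G : cograph) (P : term G -> Prop) : V G -> Prop :=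
| kspan0 : kspan P 0
| kspanS a d x : P d -> kspan P x -> kspan P (pc G a *: term_val d + x).

Lemma kspanD (G : cograph) P (x y : V G) : kspan P x -> kspan P y -> kspan P (x + y).
Proof.
move=> Px Py; elim: Px => [|a d z Pd _ IHz]; first by rewrite add0r.
by rewrite -addrA; apply: kspanS.
Qed.

Lemma kspanZ (G : cograph) P a (x : V G) : kspan P x -> kspan P (pc G a *: x).
Proof.
elim=> [|b d z Pd _ IHz]; first by rewrite scaler0; apply: kspan0.
by rewrite scalerDr scalerA -polyconstM; apply: kspanS.
Qed.

Lemma kspanN (G : cograph) P (x : V G) : kspan P x -> kspan P (- x).
Proof. by rewrite -scaleN1r -polyconst1 -polyconstN; apply: kspanZ. Qed.

Lemma kspanW (G : cograph) (P Q : term G -> Prop) (x : V G) :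
  (forall d, P d -> Q d) -> kspan P x -> kspan Q x.
Proof. by move=> PQ; elim=> [|a d z /PQ Qd _]; [apply: kspan0 | apply: kspanS]. Qed.

Lemma kspan_act (G H : cograph) (f : embedding G H) m P Q (x : V G) :
  (forall d, P d -> Q (term_act f m d)) ->
  kspan P x -> kspan Q (mon m *: trans f x).
Proof.
move=> PQ; elim=> [|a d z Pd _ IHz]; first by rewrite trans0 scaler0; apply: kspan0.
rewrite transD transZ scalerDr scalerA mulrC -scalerA -term_val_act.
by apply: kspanS => //; apply: PQ.
Qed.

Hypothesis vs_gen : forall (G : cograph) (x : V G),
  generated (fun y => exists j (f : embedding (Gs j) G), y = trans f (vs j)) x.

(** A polynomial is a combination of monomials, and a monomial times a term is a term; so the k-span
    of the terms is a submodule containing the images of the generators. *)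
Lemma kspan_full (G : cograph) (x : V G) : kspan (fun=> True) x.
Proof.
apply: generated_sub (vs_gen x); last first.
  move=> _ [j [f ->]].
  pose d : term G := (Tagged (fun j => embedding (Gs j) G) f, [ffun=> 0%N]).
  have := @kspanS G (fun=> True) 1 d 0 I (kspan0 _).
  by rewrite /term_val mon0 polyconst1 !scale1r addr0.
split=> [|p y z Sy Sz]; first exact: kspan0.
apply: kspanD => //; elim/poly_ind: p => [|a m p IHp].
  by rewrite scale0r; apply: kspan0.
rewrite scalerDl -scalerA; apply: kspanD => //; apply: kspanZ.
rewrite -[y]trans_id; exact: (kspan_act (P := fun=> True)).
Qed.

(** * Labels and codes of terms *)

Definition term_label (G : sgraph) (d : term G) (v : G) :
  option {j : J & Gs j} :=
  omap (Tagged (fun j => vertex (Gs j))) [pick u | tagged d.1 u == v].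

Lemma term_label_emb (G : sgraph) (d : term G) u :
  term_label d (tagged d.1 u) = Some (Tagged (fun j => vertex (Gs j)) u).
Proof.
rewrite /term_label; case: pickP => [u' /eqP/emb_inj-> //|/(_ u)].
by rewrite eqxx.
Qed.

(** The label at the image of a vertex [u] names both the generator and [u], so the labels determine
    the embedding; any vertex of the generator fixes the index. *)
Lemma term_label_head (G H : sgraph) (f : embedding G H) (d : term G) (d' : term H) :
  (forall v, term_label d v = term_label d' (f v)) ->
  d'.1 = Tagged (fun j => embedding (Gs j) H) (comp_emb f (tagged d.1)).
Proof.
move=> labP; have {labP} : forall u, term_label d' (f (tagged d.1 u)) =
    Some (Tagged (fun j => vertex (Gs j)) u).
  by move=> u; rewrite -labP term_label_emb.
case: d d' => [[j g] m] [[j' g'] m'] /=; rewrite /term_label /=.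
move=> labP; have eq_j : j' = j.
  have [x _] := cograph_vertex (cographP (Gs j)).
  by case: pickP (labP x) => //= y _ /Some_inj/(congr1 tag).
case: _ / eq_j in g labP *; congr Tagged; apply: embP => u.
case: pickP (labP u) => //= y /eqP eq_y /Some_inj/eqP.
rewrite eq_Tagged /= => /eqP eq_yu.
by rewrite comp_embE -eq_y eq_yu.
Qed.

(** The cofactor is the difference of the exponents; off the image of [f] the subtracted exponent is
    0, so the subtraction never truncates. *)
Lemma term_act_dvd (G H : sgraph) (f : embedding G H) (d : term G) (d' : term H) :
  (forall v, term_label d v = term_label d' (f v)) ->
  (forall v i, d.2 (v, i) <= d'.2 (f v, i))%N ->
  exists m, d' = term_act f m d.
Proof.
move=> /term_label_head labP le_d.
exists [ffun p => d'.2 p - push f d.2 p]%N; rewrite /term_act -labP.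
have {le_d} : forall p, (push f d.2 p <= d'.2 p)%N.
  case=> v i; case: (pickP (fun u => f u == v)) => [u /eqP <-|nov].
    by rewrite push_emb.
  by rewrite push_out // => u; rewrite nov.
move: (push f d.2) => n le_n; case: d' {labP} le_n => h m' /= le_n; congr pair.
by apply/ffunP => p; rewrite !ffunE subnK.
Qed.

(* [None] records which vertex of which generator, if any, sits at the given
   vertex; this makes the code of a term determine it. *)
Definition term_code (G : sgraph) (d : term G) : {ffun G * option 'I_c -> nat} :=
  [ffun p => if p.2 is Some i then d.2 (p.1, i) else choice.pickle (term_label d p.1)].

Lemma term_code_var (G : sgraph) (d : term G) (v : G) i :
  term_code d (v, Some i) = d.2 (v, i).
Proof. by rewrite ffunE. Qed.

Lemma term_code_label (G : sgraph) (d : term G) (v : G) :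
  term_code d (v, None) = choice.pickle (term_label d v).
Proof. by rewrite ffunE. Qed.

Lemma term_act_var (G H : sgraph) (f : embedding G H) m d p :
  (term_act f m d).2 p = (m p + push f d.2 p)%N.
Proof. by rewrite ffunE. Qed.

Lemma term_code_inj G : injective (@term_code G).
Proof.
move=> d d' eq_c; have codeP p : term_code d p = term_code d' p by rewrite eq_c.
have labP v : term_label d v = term_label d' v.
  by have := codeP (v, None); rewrite !ffunE => /(pcan_inj choice.pickleK).
case: d d' {eq_c} codeP labP => [h m] [h' m'] codeP labP; congr pair; last first.
  by apply/ffunP => -[v i]; have := codeP (v, Some i); rewrite !ffunE.
rewrite -[h']/(h', m').1 (@term_label_head _ _ (id_emb G) (h, m) (h', m')) /=.
  case: h {codeP labP} => j f; congr Tagged; apply: embP => u.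
  by rewrite comp_embE id_embE.
by move=> v; rewrite id_embE.
Qed.

(** * The lexicographic order on terms *)

Section TermOrder.

(** Index 0 makes the label be compared before the exponents at the same vertex. *)
Definition var_index (o : option 'I_c) : nat := if o is Some i then i.+1 else 0%N.

Lemma var_index_lt o : (var_index o < c.+1)%N.
Proof. by case: o => // i; rewrite ltnS ltn_ord. Qed.

Definition var_rank T (p : tree_graph T * option 'I_c) : nat :=
  (leaf_rank p.1 * c.+1 + var_index p.2)%N.

Lemma var_rank_lt T (p q : tree_graph T * option 'I_c) :
  (var_rank p < var_rank q)%N = (leaf_rank p.1 < leaf_rank q.1)%N
    || (leaf_rank p.1 == leaf_rank q.1) && (var_index p.2 < var_index q.2)%N.
Proof.
rewrite /var_rank; have := var_index_lt p.2; have := var_index_lt q.2.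
case: (ltngtP (leaf_rank p.1) (leaf_rank q.1)) => /= [||->]; [nia | nia |].
by rewrite ltn_add2l.
Qed.

Lemma var_rank_inj T : injective (@var_rank T).
Proof.
move=> [v o] [w o'] eq_r.
have := var_rank_lt (v, o) (w, o'); have := var_rank_lt (w, o') (v, o).
rewrite eq_r ltnn /=.
case: (ltngtP (leaf_rank v) (leaf_rank w)) => //= /leaf_rank_inj->.
case: (ltngtP (var_index o) (var_index o')) => //= eq_o _ _; congr pair.
by case: o o' eq_o {eq_r} => [i|] [j|] //= [/val_inj->].
Qed.

Definition term_lt T (d d' : term (tree_graph T)) : Prop :=
  lex (@var_rank T) (term_code d) (term_code d').

Lemma term_lt_trans T (d1 d2 d3 : term (tree_graph T)) :
  term_lt d1 d2 -> term_lt d2 d3 -> term_lt d1 d3.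
Proof. exact/lex_trans/var_rank_inj. Qed.

Lemma term_lt_total T (d d' : term (tree_graph T)) :
  d = d' \/ term_lt d d' \/ term_lt d' d.
Proof.
case: (classic (term_code d = term_code d')) => [/term_code_inj|]; first by left.
by move/(lex_total (@var_rank T)); right.
Qed.

Variables (T T' : tree unit) (f : embedding (tree_graph T) (tree_graph T')).
Hypothesis f_mono : forall u v, (leaf_rank u < leaf_rank v)%N ->
  (leaf_rank (f u) < leaf_rank (f v))%N.
Variable m : {ffun tree_graph T' * 'I_c -> nat}.

Lemma var_rank_emb p q :
  (var_rank (f p.1, p.2) < var_rank (f q.1, q.2))%N = (var_rank p < var_rank q)%N.
Proof.
rewrite !var_rank_lt /=; case: (ltngtP (leaf_rank p.1) (leaf_rank q.1)) => /=.
- by move/f_mono->.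
- by move/f_mono=> lt_f; rewrite ltnNge ltnW //= gtn_eqF.
by move/leaf_rank_inj->; rewrite ltnn eqxx.
Qed.

Lemma code_act_emb d p : term_code (term_act f m d) (f p.1, p.2) =
  ((if p.2 is Some i then m (f p.1, i) else 0) + term_code d p)%N.
Proof.
case: p => v [i|]; first by rewrite !term_code_var term_act_var push_emb.
rewrite !term_code_label; congr (choice.pickle (omap _ _)); apply: eq_pick => u /=.
by rewrite comp_embE (inj_eq (@emb_inj _ _ f)).
Qed.

Lemma code_act_out d d' v o : (forall u, f u != v) ->
  term_code (term_act f m d) (v, o) = term_code (term_act f m d') (v, o).
Proof.
move=> nov; case: o => [i|].
  by rewrite !term_code_var !term_act_var !push_out.
have nolab (e : term (tree_graph T)) : term_label (term_act f m e) v = None.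
  by rewrite /term_label; case: pickP => // u; rewrite comp_embE (negPf (nov _)).
by rewrite !term_code_label !nolab.
Qed.

(** On the image of [f] both codes are shifted by the same amount, off it they agree, and [f]
    respects ranks; so the first difference goes to the first difference. *)
Lemma term_lt_act d d' :
  term_lt d d' -> term_lt (term_act f m d) (term_act f m d').
Proof.
case=> p [lt_p eq_p]; exists (f p.1, p.2); split=> [|[v o]].
  by rewrite !code_act_emb ltn_add2l.
case: (pickP (fun u => f u == v)) => [u /eqP <-|nov _]; last first.
  by apply: code_act_out => u; rewrite nov.
by rewrite (var_rank_emb (u, o)) !(code_act_emb _ (u, o)) => /eq_p->.
Qed.

End TermOrder.

(* [a] may be 0, and since the terms need not be linearly independent an element
   can have several leading terms. *)
Definition lead T (d : term (tree_cograph T)) (a : k) (w : V (tree_cograph T)) : Prop :=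
  exists u, @kspan (tree_cograph T) (fun d' => term_lt d' d) u
    /\ w = pc _ a *: term_val d + u.

(** Terms are added one at a time and the larger one is kept. Equal terms have their coefficients
    added, possibly to 0, which [lead] allows. *)
Lemma kspan_lead T (P : term (tree_cograph T) -> Prop) (w : V (tree_cograph T)) :
  kspan P w ->
  w = 0 \/ exists d a, P d /\ lead d a w.
Proof.
elim=> [|a d z Pd _ [->|[d' [a' [Pd' [u [Su ->]]]]]]]; first by left.
  by right; exists d, a; split=> //; exists 0; split=> //; apply: kspan0.
right; case: (term_lt_total d d') => [eq_d|[lt_d|lt_d]].
- subst d'; exists d, (a + a'); split=> //; exists u; split=> //.
  by rewrite polyconstD scalerDl addrA.
- exists d', a'; split=> //; exists (pc _ a *: term_val d + u).
  by split; [apply: kspanS | rewrite addrCA].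
exists d, a; split=> //; exists (pc _ a' *: term_val d' + u); split=> //.
by apply: kspanS => //; apply: kspanW Su => d1 /term_lt_trans; apply.
Qed.

Lemma lead0 T (d : term (tree_cograph T)) : lead d 0 0.
Proof.
by exists 0; split; [apply: kspan0 | rewrite polyconst0 scale0r addr0].
Qed.

Lemma lead_linear T (d : term (tree_cograph T)) a b c' w w' :
  lead d b w -> lead d c' w' -> lead d (a * b + c') (pc _ a *: w + w').
Proof.
move=> [u [Su ->]] [u' [Su' ->]]; exists (pc _ a *: u + u'); split.
  exact: (kspanD (kspanZ a Su) Su').
have -> : pc (tree_cograph T) (a * b + c') = pc _ a * pc _ b + pc _ c'.
  by rewrite -polyconstM -polyconstD.
exact: scale_lin_comb.
Qed.

Lemma lead_act T T' (f : embedding (tree_cograph T) (tree_cograph T')) m d a w :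
  (forall u v : tree_graph T, (leaf_rank u < leaf_rank v)%N ->
    (leaf_rank (f u) < leaf_rank (f v))%N) ->
  lead d a w -> lead (term_act f m d) a (mon m *: trans f w).
Proof.
move=> f_mono [u [Su ->]]; exists (mon m *: trans f u); split.
  by apply: kspan_act Su => d'; apply: term_lt_act.
by rewrite transD transZ scalerDr scalerA mulrC -scalerA term_val_act.
Qed.

(** * Divisibility of terms through labelled cotrees *)

Definition term_tree T (d : term (tree_graph T)) :
    tree ({ffun 'I_c -> nat} * option {j : J & Gs j}) :=
  relabel (fun v => ([ffun i => d.2 (v, i)], term_label d v)).

(** The second components range over a finite type, so their equality is a well-quasi-order too. *)
Definition label_le (x y : {ffun 'I_c -> nat} * option {j : J & Gs j}) :=
  (forall i, x.1 i <= y.1 i)%N /\ x.2 = y.2.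

Lemma term_tree_emb T T' (d : term (tree_graph T)) (d' : term (tree_graph T')) :
  tree_emb label_le (term_tree d) (term_tree d') ->
  exists (f : embedding (tree_graph T) (tree_graph T')) m,
    (forall u v, (leaf_rank u < leaf_rank v)%N ->
      (leaf_rank (f u) < leaf_rank (f v))%N) /\ d' = term_act f m d.
Proof.
case/tree_emb_embedding=> f [f_mono fP].
have [v|v i|m ->] := @term_act_dvd _ _ f d d'; last by exists f, m.
  by case: (fP v).
by case: (fP v) => /(_ i); rewrite !ffunE.
Qed.

Lemma term_tree_wqo : wqo (tree_emb label_le).
Proof.
apply: kruskal => [x y z [le_xy eq_xy] [le_yz eq_yz]|].
  by split=> [i|]; [apply: leq_trans (le_yz i) | rewrite eq_xy].
exact: wqo_and (wqo_preim fst (@dickson _)) (wqo_preim snd (@wqo_fin_eq _)).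
Qed.

End Terms.

(** * Noetherianity *)

Lemma In_tnth A (x : A) s : List.In x s -> exists i, x = tnth (in_tuple s) i.
Proof.
elim: s => //= y s IHs [<-|/IHs[i ->]]; first by exists ord0.
by exists (lift ord0 i); rewrite (tnth_nth x) [in RHS](tnth_nth x).
Qed.

Section Images.
Variables (k : comNzRingType) (c : nat) (V : amodule k c).

Definition item : Type := {T : tree unit & V (tree_cograph T)}.

Definition images (P : item -> Prop) (G : cograph) (y : V G) : Prop :=
  exists it, P it /\ exists f : embedding (tree_cograph (tag it)) G,
    y = trans f (tagged it).

(** The elements whose transition image is generated form a submodule, by [trans_semilinear]. *)
Lemma generated_trans (P : item -> Prop) (G H : cograph) (f : embedding G H) x :
  generated (@images P G) x -> generated (@images P H) (trans f x).
Proof.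
move=> gx; pose N y := generated (@images P H) (trans f y).
apply: (generated_sub (N := N)) gx.
  split=> [|a y z gy gz].
    by rewrite /N trans0; case: (generated_submodule (@images P H)).
  have [b bE] := trans_semilinear V f a.
  by rewrite /N transD bE; apply: (proj2 (generated_submodule _)).
move=> _ [it [Pit [g ->]]]; rewrite /N -trans_comp; apply: generated_mem.
by exists it; split=> //; exists (comp_emb f g).
Qed.

Variable W : subamodule V.

(** Every cograph is isomorphic to the graph of a cotree, so generation needs checking on cotrees
    only. [List.In] avoids asking for a decidable equality of items. *)
Lemma sub_fg_items (s : seq item) :
  (forall it, List.In it s -> sub_val W (tagged it)) ->
  (forall T (x : V (tree_cograph T)), sub_val W x ->
     generated (@images (fun it => List.In it s) (tree_cograph T)) x) ->
  sub_fg W.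
Proof.
move=> sW s_gen.
have gen (G : cograph) (x : V G) : sub_val W x ->
    generated (@images (fun it => List.In it s) G) x.
  move=> Wx; have [T [f bij_f]] := cograph_tree (cographP G).
  have [g fg] := emb_inv bij_f.
  rewrite -[x]trans_id -fg (@trans_comp _ _ V G (tree_cograph T) G f g).
  apply: (@generated_trans _ (tree_cograph T)); apply: s_gen; exact: sub_trans.
split=> [G|].
  (* Only finitely many embeddings go into [G] from a given cotree, so the images of the items form
     a finite list. *)
  have [t tP] : exists t : seq (V G), forall y,
      y \in t <-> @images (fun it => List.In it s) G y.
    elim: s {sW s_gen gen} => [|it s [t tP]].
      by exists [::] => y; split=> // -[it []].
    pose im : seq (V G) := [seq @trans _ _ V (tree_cograph (tag it)) G f (tagged it)
      | f <- enum {: {f : {ffun tree_graph (tag it) -> G} | full_embedding f}}].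
    exists (im ++ t) => y; rewrite mem_cat.
    split=> [/orP[/mapP[f _ ->]|/tP[it' [sit' fP]]]|].
    - by exists it; split; [left | exists f].
    - by exists it'; split; [right|].
    move=> [it' [/= [<-|sit'] fP]]; apply/orP; [left | right].
      by case: fP => f ->; apply: map_f; rewrite mem_enum.
    by apply/tP; exists it'.
  exists t => x; split=> [/gen|]; apply: generated_sub; first 1 last.
  - by move=> y /tP yt; apply: generated_mem.
  - exact: sub_submodule.
  - by move=> y /tP [it [/sW Wit [f ->]]]; apply: sub_trans.
  exact: generated_submodule.
exists (size s), (fun i => tree_cograph (tag (tnth (in_tuple s) i))) => G x.
split=> [/gen|]; apply: generated_sub; first 1 last.
- move=> _ [it [sit [f ->]]]; apply: generated_mem.
  have [i eq_it] := In_tnth sit; subst it.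
  by exists i, f, (tagged (tnth (in_tuple s) i)); split=> //; apply: sW.
- exact: sub_submodule.
- by move=> _ [i [f [y [Wy ->]]]]; apply: sub_trans.
exact: generated_submodule.
Qed.

End Images.

Lemma In_mem (T : eqType) (x : T) s : x \in s -> List.In x s.
Proof. by elim: s => //= y s IHs; rewrite inE => /predU1P[->|/IHs]; [left | right]. Qed.

(** * The minimal choice argument *)

Section Noetherian.
Variables (k : comNzRingType) (c : nat) (V : amodule k c).
Variables (J : finType) (Gs : J -> cograph) (vs : forall j, V (Gs j)).
Hypothesis vs_gen : forall (G : cograph) (x : V G),
  generated (fun y => exists j (f : embedding (Gs j) G), y = trans f (vs j)) x.
Hypothesis k_noeth : noetherian_ring k.
Variable W : subamodule V.

Local Notation pc a := (polyconst c _ (a : k)).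

(** The leading term is stored, as an element need not determine it. *)
Record lead_elt := LeadElt {
  elt_tree : tree unit;
  elt_term : term c Gs (tree_cograph elt_tree);
  elt_coef : k;
  elt_val : V (tree_cograph elt_tree);
  elt_sub : sub_val W elt_val;
  elt_lead : lead vs elt_term elt_coef elt_val }.

Definition elt_item (q : lead_elt) : item V :=
  Tagged (fun T => V (tree_cograph T)) (elt_val q).

Definition elt_gen (l : seq lead_elt) (T : tree unit) : V (tree_cograph T) -> Prop :=
  generated (@images _ _ V (fun it => List.In it (map elt_item l)) (tree_cograph T)).

(** The terms over a fixed cotree are well-ordered, so a leading term of an element outside the
    submodule can be taken minimal. Only elements over that cotree are compared. *)
Lemma minimal_lead_elt (l : seq lead_elt) :
  (exists T (x : V (tree_cograph T)), sub_val W x /\ ~ elt_gen l x) ->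
  exists q : lead_elt, ~ elt_gen l (elt_val q) /\
    forall d a w, sub_val W w -> ~ elt_gen l w -> lead vs d a w ->
      ~ term_lt d (elt_term q).
Proof.
case=> T [x [Wx ngx]].
pose Q (d : term c Gs (tree_cograph T)) := exists a w,
  [/\ sub_val W w, ~ elt_gen l w & lead vs d a w].
have [|d [[a [w [Ww ngw lw]]] d_min]] :=
    lex_min (@var_rank_inj c T) (@term_code _ _ _ _) (Q := Q).
  have [x0|[d [a [_ lx]]]] := kspan_lead (kspan_full vs_gen x).
    by case: ngx; rewrite x0; apply: (proj1 (generated_submodule _)).
  by exists d, a, x.
exists (LeadElt Ww lw); split=> // d' a' w' Ww' ngw' lw'.
by apply: d_min; exists a', w'.
Qed.

(** Kruskal's theorem handles the leading terms and the Noetherian property of [k] the leading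
    coefficients. The list is reversed to match a sequence built by adding at the head. *)
Lemma lead_elt_sequence_reducible (q : nat -> lead_elt) : exists n,
  elt_gen (map q (rev (iota 0 n))) (elt_val (q n)) \/
  exists d a w, [/\ sub_val W w, ~ elt_gen (map q (rev (iota 0 n))) w, lead vs d a w
    & term_lt d (elt_term (q n))].
Proof.
have [h [h_mono hP]] := @term_tree_wqo c _ Gs (fun n => term_tree (elt_term (q n))).
have [n gen_n] := noetherian_acc (fun n => elt_coef (q (h n))) k_noeth.
exists (h n); set l := map q _; set Q := q (h n).
case: (classic (elt_gen l (elt_val Q))) => [|ngQ]; [by left | right].
(* The ideal of coefficients at the leading term of [Q] realised by elements generated by the
   earlier entries. It contains the earlier coefficients along [h], hence that of [Q]. *)
pose N (b : k^o) := exists w,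
  [/\ sub_val W w, elt_gen l w & lead vs (elt_term Q) b w].
have [|_ [i [lt_in ->]]|w [Ww gw [u [Su eq_w]]]] := @generated_sub _ _ _ N _ _ _ gen_n.
- split=> [|a x y [w [Ww gw lw]] [w' [Ww' gw' lw']]].
    exists 0; split; first by case: (sub_submodule W (tree_cograph (elt_tree Q))).
      exact: (proj1 (generated_submodule _)).
    exact: lead0.
  exists (pc a *: w + w'); split.
  - by apply: (proj2 (sub_submodule W _)).
  - by apply: (proj2 (generated_submodule _)).
  exact: lead_linear.
- have [f [m [f_mono eq_Q]]] := term_tree_emb (hP i n lt_in).
  (* The cofactor turns the leading term of the earlier element into that of [Q] and keeps its
     coefficient. *)
  exists (mon m *: trans (f : embedding (tree_cograph _) (tree_cograph _))
    (elt_val (q (h i)))).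
  have gi : elt_gen l (elt_val (q (h i))).
    apply: generated_mem; exists (elt_item (q (h i))); split.
      do 2!apply: List.in_map; apply/In_mem.
      by rewrite mem_rev mem_iota /= add0n; apply: h_mono.
    by exists (id_emb _); rewrite trans_id.
  split.
  - by apply: submoduleZ; [apply: sub_submodule | apply: sub_trans; apply: elt_sub].
  - apply: (submoduleZ _ (generated_submodule _)).
    exact: (@generated_trans _ _ V _ (tree_cograph _) (tree_cograph _) f _ gi).
  by rewrite /Q eq_Q; apply: lead_act => //; apply: elt_lead.
have [u' [Su' eq_Q]] := elt_lead Q.
(* The leading parts are equal and cancel, leaving only lower terms. *)
have eq_v : elt_val Q - w = u' - u by rewrite eq_w eq_Q opprD addrACA subrr add0r.
have WQw : sub_val W (elt_val Q - w).
  by apply: submoduleB => //; [apply: sub_submodule | apply: elt_sub].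
have ngQw : ~ elt_gen l (elt_val Q - w).
  move=> gQw; apply: ngQ; rewrite -[elt_val Q](subrK w).
  exact: (submoduleD (generated_submodule _)).
have [v0|[d [a [lt_d lead_d]]]] := kspan_lead (kspanD Su' (kspanN Su)).
  by case: ngQw; rewrite eq_v v0; apply: (proj1 (generated_submodule _)).
by exists d, a, (elt_val Q - w); split=> //; rewrite eq_v.
Qed.

Theorem subamodule_fg : sub_fg W.
Proof.
have [l lP] : exists l : seq lead_elt, forall T (x : V (tree_cograph T)),
    sub_val W x -> elt_gen l x.
  apply: NNPP => nol.
  have /choice_fun[next nextP] : forall l, exists q : lead_elt, ~ elt_gen l (elt_val q) /\
    forall d a w, sub_val W w -> ~ elt_gen l w -> lead vs d a w ->
      ~ term_lt d (elt_term q).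
    move=> l; apply: minimal_lead_elt; apply: NNPP => nox; apply: nol; exists l => T x Wx.
    by apply: NNPP => ngx; apply: nox; exists T, x.
  (* [pref n] holds the first [n] choices, latest first, each made relative to the ones before. *)
  pose pref n := iter n (fun l => next l :: l) [::].
  have prefE n : pref n = map (fun n => next (pref n)) (rev (iota 0 n)).
    by elim: n => // n IHn; rewrite -addn1 iotaD rev_cat /= add0n -IHn addn1.
  have [n] := lead_elt_sequence_reducible (fun n => next (pref n)).
  rewrite -prefE; case: (nextP (pref n)) => ng min_n [//|[d [a [w [Ww ngw lw lt_d]]]]].
  exact: min_n Ww ngw lw lt_d.
apply: (@sub_fg_items _ _ _ _ (map elt_item l)) lP => it.
by move=> /List.in_map_iff[q [<- _]]; apply: elt_sub.
Qed.

End Noetherian.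

Theorem theorem4p1 (k : comNzRingType) (c : nat) :
  noetherian_ring k ->
  forall V : amodule k c, amod_fg V ->
  forall W : subamodule V, sub_fg W.
Proof.
move=> k_noeth V [fgV [n [Gs genV]]] W.
have /choice_fun[s sP] : forall i, exists s : seq (V (Gs i)),
    forall x, generated (fun y => y \in s) x.
  by move=> i; case: (fgV (Gs i)) => s sP; exists s => x; apply/sP.
(* A single generator is given by [i] and a position in the finite generating list of the value at
   [Gs i]. *)
pose J : finType := {i : 'I_n & 'I_(size (s i))}.
pose vs (j : J) : V (Gs (tag j)) := nth 0 (s (tag j)) (tagged j).
apply: (@subamodule_fg k c V J (fun j => Gs (tag j)) vs) => // G x.
have [/(_ I) gx _] := genV G x.
apply: generated_sub gx; first exact: generated_submodule.
move=> _ [i [f [y [_ ->]]]]; set S := fun y => _.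
apply: (generated_sub (N := fun y => generated S (trans f y))) (sP i y).
  split=> [|a y' z gy gz]; first by rewrite trans0; case: (generated_submodule S).
  have [b bE] := trans_semilinear V f a.
  by rewrite transD bE; apply: (proj2 (generated_submodule _)).
move=> z zs; apply: generated_mem.
have lt_z : (index z (s i) < size (s i))%N by rewrite index_mem.
exists (Tagged (fun i => 'I_(size (s i))) (Ordinal lt_z)), f.
by rewrite /vs /= nth_index.
Qed.
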